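(* Let $\alpha_0>0$, $\alpha_1>0$, $0\le\sigma<1$, $\Delta_f>0$ and $\Delta_*$ satisfy $(\Delta_f\alpha_1/\alpha_0)^{1/(1-\sigma)}\le\Delta_*$, and let $\Xi_1(\Delta_* )$ be the corresponding class of control problems (defined in the context). Let $\Gamma=\Gamma^{T}>0$ be an $m\times m$ gain matrix, $\lambda=\lambda_{\min}(\Gamma)$ its smallest eigenvalue, $k>0$, and $\zeta:\mathbb{R}^m\to\mathbb{R}^m$. For each problem of $\Xi_1(\Delta_* )$, with plant $$\dot x(t)=F(x(t),\theta(t),t)+f(t),$$ goal function $Q$ and $w(x,\theta,t)=\nabla Q(x)^{T}F(x,\theta,t)$, consider the adaptation algorithm $$\frac{d}{dt}\bigl[\theta+\psi(x,\theta,t)\bigr]=-\Gamma\bigl[k\,\nabla_\theta w(x,\theta,t)+\zeta\bigl(\theta+\psi(x,\theta,t)\bigr)\bigr],$$ where $\psi$ satisfies the pseudogradient condition $\psi(x,\theta,t)^{T}\nabla_\theta w(x,\theta,t)\ge 0$ for all $x,\theta$ and $t\ge 0$. Suppose that condition NF holds with constants $\rho>0$, $\rho'>0$: $\zeta(\theta)^{T}(\theta-\theta_* )\ge\rho\|\theta-\theta_*\|^2-\rho'$ for all $\theta\in\mathbb{R}^m$, where $\theta_*$ is the vector from the attainability assumption A4 of the problem. Suppose also that $2\rho\lambda\ge\alpha_0(1-\sigma)$. Then: (i) for any problem from $\Xi_1(\Delta_* )$ the closed-loop system consisting of the plant and the algorithm is ultimately bounded; (ii) for every $\epsilon>0$,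 if $k>k_0$, where $k_0=2\rho'[\epsilon\alpha_0(1-\sigma)]^{-1}$, then the algorithm is estimatedly $\epsilon$-optimal in the class $\Xi_1(\Delta_* )$.
   Context: Plant and goal. The state is $x\in\mathbb{R}^n$, the adjustable vector is $\theta\in\mathbb{R}^m$, the plant is $\dot x=F(x,\theta,t)+f(t)$ with disturbance $f$. The goal function $Q:\mathbb{R}^n\to[0,\infty)$ is smooth, and $w(x,\theta,t)=\nabla Q(x)^{T}F(x,\theta,t)$ is differentiable in $\theta$. A control algorithm $\Theta$ is a rule generating $\theta(t)$. Solutions $(x(t),\theta(t))$ of the closed-loop system are understood in the usual sense and are considered on $[0,\infty)$. Class $\Xi$. Fix constants $\alpha_0>0$, $\alpha_1>0$, $0\le\sigma<1$, $\Delta_f>0$. The class $\Xi$ consists of all control problems $\xi=(F,f,Q,A_\xi)$ such that: A1 (regularity): $F(x,\theta,t)$, $\nabla Q(x)$, $\nabla_\theta w(x,\theta,t)$ are bounded locally in $(x,\theta)$, uniformly in $t\ge0$. A2 (growth): $Q$ is continuous and $Q(x)\to+\infty$ as $\|x\|\to\infty$. A3 (convexity): $w$ is convex in $\theta$: for all $x,\theta,\theta'$ and $t\ge0$, $w(x,\theta',t)-w(x,\theta,t)\ge(\theta'-\theta)^{T}\nabla_\theta w(x,\theta,t)$. A4 (attainability): there exists a vector $\theta_*\in\mathbb{R}^m$ (depending on the problem) such that $w(x,\theta_*,t)\le-\alpha_0Q(x)$ for all $x$ and $t\ge0$. A5: $\|\nabla Q(x)\|\le\alpha_1Q(x)^{\sigma}$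 for all $x$. A6: $\|f(t)\|\le\Delta_f$ for all $t\ge0$. A7: $A_\xi$ is the set of algorithms producing constant controls $\theta(t)\equiv\theta\in\mathbb{R}^m$. $\Xi_1(\Delta_* )$ denotes the class $\Xi$ when $(\Delta_f\alpha_1/\alpha_0)^{1/(1-\sigma)}\le\Delta_*$ for the given number $\Delta_*$. Ultimate boundedness. The closed-loop system is ultimately bounded if there is $\Delta>0$ such that $\limsup_{t\to\infty}Q(x(t))\le\Delta$ along its solutions. Functional and optimality. $J(\xi,\Theta)=\limsup_{t\to\infty}Q(x(t))$, where $x(t)$ is a solution of the plant of problem $\xi$ closed by the algorithm $\Theta$; bounds on $J$ are required for every solution. $\Delta_*$ is an estimate of the optimum of $J$ in a class if for every problem $\xi$ of the class there is an algorithm $\Theta_\xi^*\in A_\xi$ with $J(\xi,\Theta_\xi^* )\le\Delta_*$. Given such an estimate $\Delta_*$ and $\epsilon>0$, an algorithm $\Theta$ (not required to belong to $A_\xi$) is called estimatedly $\epsilon$-optimal in the class if $J(\xi,\Theta)\le\Delta_*+\epsilon$ for every problem $\xi$ of the class. *)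

(* Defs.v *)
From HB Require Import structures.
From mathcomp Require Import all_boot all_order all_algebra.
From mathcomp Require Import all_classical all_reals all_analysis.

Set Implicit Arguments.
Unset Strict Implicit.
Unset Printing Implicit Defensive.

Import Order.TTheory GRing.Theory Num.Theory.
Import numFieldNormedType.Exports.

Local Open Scope classical_set_scope.
Local Open Scope ring_scope.

(* The norm that 'cV[R]_p carries in the library is the sup norm; norms in the
   mathematics are Euclidean, hence [enorm].  The two are equivalent, so
   limits, derivatives and neighborhoods are the library ones. *)
Definition dot (R : realType) (p : nat) (u v : 'cV[R]_p) : R :=
  \sum_(i < p) u i 0 * v i 0.

Definition enorm (R : realType) (p : nat) (u : 'cV[R]_p) : R :=
  Num.sqrt (dot u u).

Definition grad (R : realType) (p : nat) (g : 'cV[R]_p -> R) (x : 'cV[R]_p) :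
    'cV[R]_p :=
  \col_(i < p) 'D_(delta_mx i 0) g x.

Definition posdefmx (R : realType) (p : nat) (A : 'M[R]_p) : Prop :=
  A^T = A /\ forall v : 'cV[R]_p, v != 0 -> 0 < dot v (A *m v).

Definition smallest_eigenvalue (R : realType) (p : nat) (A : 'M[R]_p)
    (lambda : R) : Prop :=
  eigenvalue A lambda /\ forall mu : R, eigenvalue A mu -> lambda <= mu.

(* The elements of [s] are the pairs of endpoints of non-overlapping
   subintervals of [a, b], listed from left to right. *)
Definition abs_continuous (R : realType) (p : nat) (y : R -> 'cV[R]_p)
    (a b : R) : Prop :=
  forall eps : R, 0 < eps ->
  exists2 delta : R, 0 < delta &
    forall s : seq (R * R),
      all (fun I => [&& a <= I.1, I.1 <= I.2 & I.2 <= b]) s ->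
      pairwise (fun I J => I.2 <= J.1) s ->
      \sum_(I <- s) (I.2 - I.1) < delta ->
      \sum_(I <- s) enorm (y I.2 - y I.1) < eps.

(* y' = g on [0, +oo[ in the sense of Caratheodory.  The disturbance is only
   assumed bounded, so that y cannot be expected to be differentiable
   everywhere; C^1 solutions are a special case. *)
Definition solves (R : realType) (p : nat) (y g : R -> 'cV[R]_p) : Prop :=
  (forall T : R, 0 < T -> abs_continuous y 0 T) /\
  {ae @lebesgue_measure R, forall t : R, 0 < t -> is_derive t (1 : R) y (g t)}.

(* A control algorithm is the relation between the state trajectories x and
   the control trajectories theta that are compatible with its rule (the rule
   may determine theta only implicitly). *)
Definition algorithm (R : realType) (n m : nat) : Type :=
  (R -> 'cV[R]_n) -> (R -> 'cV[R]_m) -> Prop.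

Definition const_algorithm (R : realType) (n m : nat) (th : 'cV[R]_m) :
    algorithm R n m :=
  fun _ theta => forall t : R, 0 <= t -> theta t = th.

Record problem (R : realType) (n m : nat) : Type := Problem {
  plant : 'cV[R]_n -> 'cV[R]_m -> R -> 'cV[R]_n ;
  disturbance : R -> 'cV[R]_n ;
  goal : 'cV[R]_n -> R ;
  admissible : set (algorithm R n m)
}.

Section Problem.
Context (R : realType) (n m : nat).
Implicit Types xi : problem R n m.

Definition speed xi (x : 'cV[R]_n) (th : 'cV[R]_m) (t : R) : R :=
  dot (grad (goal xi) x) (plant xi x th t).

Definition grad_speed xi (x : 'cV[R]_n) (th : 'cV[R]_m) (t : R) : 'cV[R]_m :=
  grad (fun th' => speed xi x th' t) th.

Definition locally_bounded (p : nat)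
    (g : 'cV[R]_n -> 'cV[R]_m -> R -> 'cV[R]_p) : Prop :=
  forall (x : 'cV[R]_n) (th : 'cV[R]_m), exists M : R,
    \forall x' \near x & th' \near th,
      forall t : R, 0 <= t -> enorm (g x' th' t) <= M.

Definition attains (alpha0 : R) xi (th : 'cV[R]_m) : Prop :=
  forall (x : 'cV[R]_n) (t : R), 0 <= t ->
    speed xi x th t <= - alpha0 * goal xi x.

(* Smoothness of the goal function is taken as continuous differentiability,
   the weakest usual meaning. *)
Record Xi (alpha0 alpha1 sigma Delta_f : R) xi : Prop := {
  goal_ge0 : forall x, 0 <= goal xi x ;
  goal_differentiable : forall x, differentiable (goal xi) x ;
  goal_grad_continuous : continuous (grad (goal xi)) ;
  speed_differentiable : forall x th t, 0 <= t ->
    differentiable (fun th' => speed xi x th' t) th ;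
  plant_bounded : locally_bounded (plant xi) ;
  grad_goal_bounded : locally_bounded (fun x _ _ => grad (goal xi) x) ;
  grad_speed_bounded : locally_bounded (grad_speed xi) ;
  goal_continuous : continuous (goal xi) ;
  goal_growth : forall M : R, exists r : R,
    forall x, r < enorm x -> M < goal xi x ;
  speed_convex : forall x th th' t, 0 <= t ->
    dot (th' - th) (grad_speed xi x th t) <=
      speed xi x th' t - speed xi x th t ;
  attainable : exists th, attains alpha0 xi th ;
  grad_goal_growth : forall x,
    enorm (grad (goal xi) x) <= alpha1 * (goal xi x `^ sigma) ;
  disturbance_bounded : forall t, 0 <= t -> enorm (disturbance xi t) <= Delta_f ;
  admissible_const : admissible xi = range (@const_algorithm R n m)
}.

Definition Xi1 (alpha0 alpha1 sigma Delta_f Delta_star : R) :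
    set (problem R n m) :=
  [set xi | Xi alpha0 alpha1 sigma Delta_f xi /\
     (Delta_f * alpha1 / alpha0) `^ (1 - sigma)^-1 <= Delta_star].

Definition closed_loop xi (Theta : algorithm R n m)
    (x : R -> 'cV[R]_n) (theta : R -> 'cV[R]_m) : Prop :=
  solves x (fun t => plant xi (x t) (theta t) t + disturbance xi t) /\
  Theta x theta.

Definition limsup_goal xi (x : R -> 'cV[R]_n) : \bar R :=
  limf_esup (fun t : R => (goal xi (x t))%:E) (+oo%R : set_system R).

(* J(xi, Theta) <= c: the bound is required along every solution. *)
Definition J_le xi (Theta : algorithm R n m) (c : R) : Prop :=
  forall x theta, closed_loop xi Theta x theta ->
    (limsup_goal xi x <= c%:E)%E.

Definition ultimately_bounded xi (Theta : algorithm R n m) : Prop :=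
  exists2 Delta : R, 0 < Delta &
    forall x theta, closed_loop xi Theta x theta ->
      (limsup_goal xi x <= Delta%:E)%E.

Definition optimum_estimate (C : set (problem R n m)) (Delta_star : R) : Prop :=
  forall xi, C xi -> exists2 Theta, admissible xi Theta & J_le xi Theta Delta_star.

(* The algorithm under consideration may use the data of the problem, such as
   the gradient of [speed], hence depends on xi; it need not be admissible. *)
Definition estimatedly_optimal (C : set (problem R n m)) (Delta_star eps : R)
    (Theta : problem R n m -> algorithm R n m) : Prop :=
  optimum_estimate C Delta_star /\
  forall xi, C xi -> J_le xi (Theta xi) (Delta_star + eps).

Definition pseudogradient xi
    (psi : 'cV[R]_n -> 'cV[R]_m -> R -> 'cV[R]_m) : Prop :=
  forall x th t, 0 <= t -> 0 <= dot (psi x th t) (grad_speed xi x th t).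

(* Differential equation for theta + psi: theta itself need be neither
   differentiable nor continuous. *)
Definition adaptation (Gamma : 'M[R]_m) (k : R) (zeta : 'cV[R]_m -> 'cV[R]_m)
    xi (psi : 'cV[R]_n -> 'cV[R]_m -> R -> 'cV[R]_m) : algorithm R n m :=
  fun x theta =>
    let eta t := theta t + psi (x t) (theta t) t in
    solves eta (fun t =>
      - (Gamma *m (k *: grad_speed xi (x t) (theta t) t + zeta (eta t)))).

End Problem.

Definition condition_NF (R : realType) (m : nat)
    (zeta : 'cV[R]_m -> 'cV[R]_m) (rho rho' : R) (th_star : 'cV[R]_m) : Prop :=
  forall th : 'cV[R]_m,
    rho * enorm (th - th_star) ^+ 2 - rho' <= dot (zeta th) (th - th_star).

(* Main.v *)
Require Import Defs.
From mathcomp Require Import all_boot all_order all_algebra.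
From mathcomp Require Import all_classical all_reals all_analysis.
From mathcomp Require Import measurable_realfun ring lra.

(* With z = theta + psi - theta_*, beta = alpha0 (1 - sigma) and
   d = (Delta_f alpha1 / alpha0)^(1 / (1 - sigma)), the Lyapunov function
   V = Q(x) + z^T Gamma^-1 z / (2 k) satisfies V' <= - beta (V - c) almost
   everywhere, where c = d + rho' / (k beta): convexity, attainability and the
   pseudogradient condition cancel the terms in the gradient of w, Young's
   inequality absorbs the disturbance, and NF together with
   2 rho lambda >= beta dominates the quadratic term.  Since V is absolutely
   continuous, V - c decays like exp(- beta t), and Q <= V.  For the constant
   control theta_* the same argument with V = Q gives the estimate d.

   An absolutely continuous function with almost everywhere nonpositive
   derivative is nonincreasing: the exceptional null set is covered by an open
   set so small that the function varies little on it, and a Cousin-type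
   covering of the interval handles both kinds of points at once. *)

Set Implicit Arguments.
Unset Strict Implicit.
Unset Printing Implicit Defensive.

Import Order.TTheory GRing.Theory Num.Theory.
Import numFieldNormedType.Exports.

Local Open Scope classical_set_scope.
Local Open Scope ring_scope.

(** * Monotonicity of absolutely continuous functions *)

(** Let [c] be the supremum of the points reachable from [a]. The neighborhood of [c] joins a
    reachable point just left of [c] to points right of it, so [c] cannot lie below [b]. The local
    hypothesis concerns only intervals containing the tag [t], which suits differentiability at
    [t]. *)
Lemma segment_induction (R : realType) (P : R -> R -> Prop) (a b : R) :
  a <= b ->
  (forall u v w, a <= u -> u <= v -> v <= w -> w <= b ->
    P u v -> P v w -> P u w) ->
  (forall t, a <= t -> t <= b -> exists2 d : R, 0 < d &
    forall u v, a <= u -> u <= t -> t <= v -> v <= b ->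
      t - d < u -> v < t + d -> P u v) ->
  P a b.
Proof.
move=> ab Pcat Ploc.
pose S := [set s | [/\ a <= s, s <= b & P a s]].
have Sa : S a.
  split => //; have [d d0 Pd] := Ploc a (lexx a) ab.
  by apply: Pd => //; lra.
have hsS : has_sup S by split; [exists a | exists b => s []].
have Sle := ub_le_sup hsS.2.
set c := sup S in Sle.
have ac : a <= c by exact: Sle.
have cb : c <= b by apply: ge_sup; [exists a | move=> s []].
have [d d0 Pd] := Ploc c ac cb.
have [s [as_ sb Ps] cds] := sup_adherent d0 hsS.
have sc : s <= c by exact: Sle.
have Sstep e : c <= e -> e <= b -> e < c + d -> S e.
  move=> ce eb ecd; split => //; first lra.
  by apply: (Pcat a s e) => //; [lra | apply: Pd => //; lra].
have [bcd|cdb] := ltP b (c + d / 2).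
  have [] // : S b by apply: Sstep => //; lra.
have : S (c + d / 2) by apply: Sstep => //; lra.
move=> /Sle; rewrite -/c; lra.
Qed.

(* [abs_continuous y a b] is, by conversion,
   [small_increments (fun u v => enorm (y v - y u)) a b]. *)
Definition small_increments (R : realType) (d : R -> R -> R) (a b : R) : Prop :=
  forall eps : R, 0 < eps -> exists2 delta : R, 0 < delta &
    forall s : seq (R * R),
      all (fun I => [&& a <= I.1, I.1 <= I.2 & I.2 <= b]) s ->
      pairwise (fun I J => I.2 <= J.1) s ->
      \sum_(I <- s) (I.2 - I.1) < delta ->
      \sum_(I <- s) d I.1 I.2 < eps.

Lemma open_small_superset (R : realType) (N : set R) (e : R) :
  (@lebesgue_measure R).-negligible N -> 0 < e ->
  exists U : set R, [/\ open U, N `<=` U & (@lebesgue_measure R U < e%:E)%E].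
Proof.
move=> [D [mD D0 ND]] e0.
have [|U [oU DU UDe]] := @lebesgue_regularity_outer R D e mD _ e0.
  by rewrite [ltLHS]D0 ltry.
exists U; split => //; first exact: subset_trans DU.
have mU : measurable U by exact: open_measurable.
have -> : lebesgue_measure U = (lebesgue_measure (U `\` D) + lebesgue_measure D)%E.
  by rewrite -[X in (_ + lebesgue_measure X)%E](setIidr DU); exact: measureDI.
by rewrite [X in (_ + X)%E]D0 adde0.
Qed.

(** Straddle estimate: since [t] lies between [u] and [v], the first-order errors [e * (v - t)] and
    [e * (t - u)] add up to exactly [e * (v - u)], and the linear terms add up to
    [(v - u) * 'D_1 h t], which is nonpositive. *)
Lemma derive_le0_increment (R : realType) (h : R -> R) (t e : R) :
  derivable h t 1 -> 'D_1 h t <= 0 -> 0 < e ->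
  exists2 d : R, 0 < d &
    forall u v, u <= t -> t <= v -> t - d < u -> v < t + d ->
      h v - h u <= e * (v - u).
Proof.
move=> ht Dt e0.
have : (fun s : R => s^-1 *: (h (s *: 1 + t) - h t)) @ 0^' --> 'D_1 h t by [].
move=> /cvgrPdist_le /(_ _ e0)[d /= d0 hd]; exists d => // u v ut tv dtu vtd.
have near_t s : `|s| < d -> `|h (s + t) - h t - s * 'D_1 h t| <= e * `|s|.
  move=> sd; have [->|s0] := eqVneq s 0.
    by rewrite add0r subrr mul0r subr0 normr0 mulr0.
  have := hd s; rewrite /ball_ /= sub0r normrN => /(_ sd s0).
  rewrite -[X in _ -> X <= _]normrN [X in _ -> `|X| <= _](_ : _ =
    s * ('D_1 h t - s^-1 *: (h (s *: 1 + t) - h t))); last first.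
    by rewrite /GRing.scale/= mulr1 mulrBr mulrA mulfV// mul1r; ring.
  by rewrite normrM mulrC => le_e; rewrite ler_pM2r ?normr_gt0.
have [vtd' utd] : `|v - t| < d /\ `|u - t| < d.
  by rewrite ger0_norm ?ler0_norm; lra.
have := near_t _ vtd'; rewrite subrK (@ger0_norm _ (v - t)); last lra.
have := near_t _ utd; rewrite subrK (@ler0_norm _ (u - t)); last lra.
rewrite !ler_norml => /andP[hu _] /andP[_ hv].
have : 0 <= (v - u) * - 'D_1 h t by apply: mulr_ge0; lra.
lra.
Qed.

Lemma small_increments_nonincreasing (R : realType) (h : R -> R) (a b : R) :
  a <= b ->
  small_increments (fun u v => `|h v - h u|) a b ->
  {ae @lebesgue_measure R, forall t, a < t -> derivable h t 1 /\ 'D_1 h t <= 0} ->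
  h b <= h a.
Proof.
move=> ab hac hae; set mu := @lebesgue_measure R.
(* The term [e * (b - a)] pays for the points of differentiability, the last [e] for the variation
   on the exceptional open set. *)
suff main (e : R) : 0 < e -> h b - h a <= e * (b - a) + e.
  rewrite -subr_le0; apply/ler_addgt0Pl => e e0; rewrite addr0.
  have ba1 : 0 < b - a + 1 by lra.
  have := main (e / (b - a + 1)) (divr_gt0 e0 ba1).
  by rewrite -[X in _ <= _ + X]mulr1 -mulrDr divfK// gt_eqF.
move=> e0; have [delta delta0 hdelta] := hac e e0.
(* The derivative is controlled only for [a < t], so the endpoint [a] joins the null set. *)
pose N := [set t | ~ (a < t -> derivable h t 1 /\ 'D_1 h t <= 0)] `|` [set a].
have N0 : mu.-negligible N.
  apply: negligibleU; first exact: hae.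
  by exists [set a]; split => //; exact: lebesgue_measure_set1.
have [U [oU NU Udelta]] := open_small_superset N0 delta0.
(* The list collects the pieces on which [h] is controlled by the smallness of
   [U] rather than by its derivative. *)
pose P u v := exists s : seq (R * R),
  [/\ all (fun I => [&& u <= I.1, I.1 <= I.2 & I.2 <= v]) s,
      pairwise (fun I J => I.2 <= J.1) s,
      ((\sum_(I <- s) (I.2 - I.1))%:E <= mu (U `&` `]u, v]))%E &
      h v - h u <= e * (v - u) + \sum_(I <- s) `|h I.2 - h I.1|].
have mU u v : measurable (U `&` `]u, v]).
  by apply: measurableI => //; exact: open_measurable.
suff [s [sab sp sU hs]] : P a b.
  apply: (le_trans hs); rewrite lerD2l; apply/ltW/hdelta => //.
  rewrite -lte_fin; apply: le_lt_trans Udelta; apply: (le_trans sU).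
  have mU' : measurable U by exact: open_measurable.
  by apply: le_measure; rewrite ?inE; [exact: mU | exact: mU' | exact: subIsetl].
apply: segment_induction => // [u v w au uv vw wb|t at_ tb].
- move=> [s [sa sp sU hs]] [s' [sa' sp' sU' hs']]; exists (s ++ s'); split.
  + rewrite all_cat; apply/andP; split.
      by apply: sub_all sa => I /and3P[-> -> /le_trans ->].
    by apply: sub_all sa' => I /and3P[/(le_trans uv) -> -> ->].
  + rewrite pairwise_cat sp sp' !andbT; apply/allrelP => I J /(allP sa)/and3P[_ _ Iv].
    by move=> /(allP sa')/and3P[vJ _ _]; exact: le_trans vJ.
  + rewrite big_cat/= EFinD (@le_trans _ _ _ _ _ (leeD sU sU'))//.
    (* Pieces are measured on half-open intervals, so adjacent ones are disjoint and their measures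
       add. *)
    rewrite -measureU; [|exact: mU|exact: mU|]; last first.
      rewrite setIACA setIid -subset0 => x [_] [] /=.
      by rewrite !in_itv/= => /andP[_ xv] /andP[]; rewrite ltNge xv.
    apply: le_measure; rewrite ?inE; [by apply: measurableU; exact: mU | exact: mU |].
    move=> x [] [Ux] /=; rewrite !in_itv/= => /andP[ux xv]; split => //=.
      by rewrite ux (le_trans xv).
    by rewrite xv (le_lt_trans uv).
  + rewrite big_cat/=; lra.
- have [Ut|Ut] := pselect (U t).
    (* Near a point of [U] the whole interval lies in [U], and is itself the single listed piece. *)
    have [d /= d0 dU] := (nbhs_ballP _ _).1 (oU t Ut); exists d => //.
    move=> u v au ut tv vb dtu vtd; exists [:: (u, v)]; split => //=.
    + by rewrite !lexx (le_trans ut tv).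
    + rewrite big_seq1/= (_ : U `&` _ = `]u, v]%classic).
        rewrite /mu lebesgue_measure_itv/= lte_fin.
        by case: ltP => uv; rewrite -?EFinB// lee_fin; lra.
      apply/setIidPr => x /=; rewrite in_itv/= => /andP[ux xv].
      apply: dU; rewrite /ball/= distrC ltr_norml; apply/andP; split; lra.
    + rewrite big_seq1/= (le_trans (ler_norm _))// lerDr mulr_ge0//; lra.
  (* Outside [U] the derivative exists and no piece has to be listed. *)
  have [ht Dt] : derivable h t 1 /\ 'D_1 h t <= 0.
    apply: contrapT => ht; apply: Ut; apply: NU.
    have [->|ta] := eqVneq t a; [by right | left => /=].
    by apply: contra_not ht; apply; rewrite lt_neqAle eq_sym ta.
  have [d d0 hd] := derive_le0_increment ht Dt e0; exists d => //.
  move=> u v au ut tv vb dtu vtd; exists [::]; split => //.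
  + by rewrite big_nil measure_ge0.
  + by rewrite big_nil addr0; exact: hd.
Qed.

(** * Calculus of small increments *)

Lemma small_increments_dominated (R : realType) (d d' : R -> R -> R) (a b L : R) :
  0 <= L ->
  (forall u v, a <= u -> u <= v -> v <= b -> d u v <= L * d' u v) ->
  small_increments d' a b -> small_increments d a b.
Proof.
move=> L0 dd' sd' e e0.
have L1 : 0 < L + 1 by lra.
have [delta delta0 hd] := sd' (e / (L + 1)) (divr_gt0 e0 L1).
exists delta => // s sab sp sdelta.
have dabs : {in s, forall I, d I.1 I.2 <= L * d' I.1 I.2}.
  by move=> I /(allP sab) /and3P[aI I12 Ib]; exact: dd'.
apply: (@le_lt_trans _ _ (L * \sum_(I <- s) d' I.1 I.2)).
  by rewrite mulr_sumr big_seq [leRHS]big_seq; exact: ler_sum.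
have := hd s sab sp sdelta; rewrite ltr_pdivlMr// => lt_e.
(* No sign is assumed of [d']: passing from [L] to [L + 1], which avoids dividing by zero, is
   monotone only when the sum is positive. *)
have [d'0|d'0] := leP (\sum_(I <- s) d' I.1 I.2) 0.
  by apply: le_lt_trans e0; rewrite mulr_ge0_le0.
by apply: le_lt_trans lt_e; rewrite mulrC ler_pM2l//; lra.
Qed.

Lemma small_incrementsD (R : realType) (d d' : R -> R -> R) (a b : R) :
  small_increments d a b -> small_increments d' a b ->
  small_increments (fun u v => d u v + d' u v) a b.
Proof.
move=> sd sd' e e0; have e2 : 0 < e / 2 by lra.
have [delta delta0 hd] := sd _ e2; have [delta' delta'0 hd'] := sd' _ e2.
exists (Num.min delta delta'); first by rewrite lt_min delta0.
move=> s sab sp; rewrite lt_min => /andP[/hd + /hd'].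
by move=> /(_ sab sp) + /(_ sab sp); rewrite big_split/=; lra.
Qed.

Lemma small_increments_id (R : realType) (a b : R) :
  small_increments (fun u v : R => v - u) a b.
Proof. by move=> e e0; exists e. Qed.

(** Boundedness passes to concatenated intervals, so [segment_induction] applies; locally, a single
    short piece changes [h] by less than 1. *)
Lemma small_increments_bounded (R : realType) (h : R -> R) (a b : R) :
  a <= b -> small_increments (fun u v => `|h v - h u|) a b ->
  exists M : R, forall t, a <= t -> t <= b -> `|h t| <= M.
Proof.
move=> ab hac.
apply: (@segment_induction _
  (fun u v => exists M : R, forall t, u <= t -> t <= v -> `|h t| <= M)) => //.
  move=> u v w au uv vw wb [M hM] [N hN]; exists (Num.max M N) => t ut tw.
  rewrite le_max; have [tv|/ltW vt] := leP t v; first by rewrite hM.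
  by rewrite hN ?orbT.
move=> t at_ tb; have [delta delta0 hd] := hac 1 ltr01.
have near_lt u v : a <= u -> u <= v -> v <= b -> v < u + delta -> `|h v - h u| < 1.
  move=> au uv vb vd; have := hd [:: (u, v)].
  by rewrite /= !big_seq1 au uv vb; apply => //=; lra.
exists delta => // u v au ut tv vb dtu vtd; exists (`|h t| + 1) => s us sv.
have : `|h s - h t| < 1.
  by have [st|/ltW ts] := leP s t; [rewrite distrC|]; apply: near_lt => //; lra.
rewrite ltr_norml => /andP[? ?].
by rewrite ler_norml; have := ler_norm (h t); have := ler_norm (- h t);
  rewrite normrN; lra.
Qed.

(** * Euclidean inner product and norm *)

Section Dot.
Context {R : realType} {p : nat}.
Implicit Types u v w : 'cV[R]_p.

Lemma dotC u v : dot u v = dot v u.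
Proof. by apply: eq_bigr => i _; rewrite mulrC. Qed.

Lemma dotDl u v w : dot (u + v) w = dot u w + dot v w.
Proof. by rewrite -big_split; apply: eq_bigr => i _; rewrite mxE mulrDl. Qed.

Lemma dotZl a u v : dot (a *: u) v = a * dot u v.
Proof. by rewrite mulr_sumr; apply: eq_bigr => i _; rewrite mxE mulrA. Qed.

Lemma dotDr u v w : dot u (v + w) = dot u v + dot u w.
Proof. by rewrite dotC dotDl !(dotC u). Qed.

Lemma dotZr a u v : dot u (a *: v) = a * dot u v.
Proof. by rewrite dotC dotZl dotC. Qed.

Lemma dotNl u v : dot (- u) v = - dot u v.
Proof. by rewrite -scaleN1r dotZl mulN1r. Qed.

Lemma dotNr u v : dot u (- v) = - dot u v.
Proof. by rewrite dotC dotNl dotC. Qed.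

Lemma dot_mulmx u v (A : 'M[R]_p) : dot u (A *m v) = dot (A^T *m u) v.
Proof.
have E x y : dot x y = (x^T *m y) 0 0.
  by rewrite mxE; apply: eq_bigr => i _; rewrite mxE.
by rewrite !E trmx_mul trmxK mulmxA.
Qed.

Lemma dot_ge0 u : 0 <= dot u u.
Proof. by apply: sumr_ge0 => i _; rewrite -expr2 sqr_ge0. Qed.

Lemma dot_eq0 u : (dot u u == 0) = (u == 0).
Proof.
apply/idP/eqP => [|->]; last first.
  by rewrite /dot big1// => i _; rewrite mxE mul0r.
rewrite psumr_eq0 => [/allP u0|i _]; last by rewrite -expr2 sqr_ge0.
apply/matrixP => i j; rewrite (ord1 j) mxE; apply/eqP.
by have := u0 i (mem_index_enum _); rewrite mulf_eq0 orbb.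
Qed.

Lemma enorm_ge0 u : 0 <= enorm u.
Proof. exact: sqrtr_ge0. Qed.

Lemma sqr_enorm u : enorm u ^+ 2 = dot u u.
Proof. by rewrite sqr_sqrtr// dot_ge0. Qed.

Lemma dot_le_enorm u v : `|dot u v| <= enorm u * enorm v.
Proof.
rewrite -sqrtrM ?dot_ge0// -sqrtr_sqr ler_sqrt ?mulr_ge0 ?dot_ge0//.
have [v0|v0] := eqVneq v 0.
  by rewrite v0 -(scale0r (0 : 'cV[R]_p)) !dotZr !mul0r mulr0 expr2 mulr0.
have vv : 0 < dot v v by rewrite lt_neqAle eq_sym dot_eq0 v0 dot_ge0.
(* This square expands to [dot v v] times the gap in the Cauchy-Schwarz inequality. *)
have := dot_ge0 (dot v v *: u - dot u v *: v).
rewrite !(dotDl, dotDr, dotNl, dotNr, dotZl, dotZr) (dotC v u) => uv0.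
rewrite -subr_ge0 -(pmulr_rge0 _ vv); lra.
Qed.

Lemma norm_le_enorm u : `|u| <= enorm u.
Proof.
rewrite /Num.Def.normr/= mx_normrE; apply: bigmax_le => [|[i j] _].
  exact: enorm_ge0.
rewrite (ord1 j)/= -sqrtr_sqr ler_sqrt ?dot_ge0// /dot (bigD1 i)//= expr2 lerDl.
by apply: sumr_ge0 => k _; rewrite -expr2 sqr_ge0.
Qed.

Lemma abs_continuous_bounded (y : R -> 'cV[R]_p) (a b : R) :
  a <= b -> abs_continuous y a b ->
  exists M : R, forall t, a <= t -> t <= b -> `|y t| <= M.
Proof.
move=> ab yac; have [|M hM] := @small_increments_bounded _ (fun t => `|y t|) a b ab.
  apply: (small_increments_dominated ler01 _ yac) => u v _ _ _.
  by rewrite mul1r; apply: le_trans (norm_le_enorm _); exact: ler_dist_dist.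
by exists M => t at_ tb; rewrite -[leLHS]normr_id hM.
Qed.

End Dot.

(** * Derivatives along trajectories *)

Lemma is_derive_coordP (R : realType) (p : nat) (y : R -> 'cV[R]_p) (t : R)
    (g : 'cV[R]_p) :
  is_derive t (1 : R) y g <->
  forall i, is_derive t (1 : R) (fun s => y s i 0) (g i 0).
Proof.
split=> [[yt <-] i|yt].
  apply: DeriveDef; first exact: (derivable_mxP _ _ _).1.
  by rewrite derive_mx// mxE.
have dy : derivable y t 1.
  by apply/derivable_mxP => i j; rewrite (ord1 j); have [] := yt i.
apply: DeriveDef => //; rewrite derive_mx//.
by apply/matrixP => i j; rewrite (ord1 j) mxE; have [_] := yt i.
Qed.

Lemma is_derive_dot (R : realType) (p : nat) (y z : R -> 'cV[R]_p) (t : R)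
    (dy dz : 'cV[R]_p) :
  is_derive t (1 : R) y dy -> is_derive t (1 : R) z dz ->
  is_derive t (1 : R) (fun s => dot (y s) (z s)) (dot dy (z t) + dot (y t) dz).
Proof.
move=> /is_derive_coordP yt /is_derive_coordP zt.
rewrite (_ : (fun _ => _) = \sum_(i < p) (fun s => y s i 0 * z s i 0)); last first.
  by apply/funext => s; rewrite fct_sumE.
rewrite -big_split/=; apply: is_derive_sum => i.
apply: (trigger_derive (is_deriveM (yt i) (zt i))).
by rewrite /GRing.scale/=; ring.
Qed.

Lemma is_derive_mulmx (R : realType) (p q : nat) (A : 'M[R]_(q, p))
    (y : R -> 'cV[R]_p) (t : R) (dy : 'cV[R]_p) :
  is_derive t (1 : R) y dy -> is_derive t (1 : R) (fun s => A *m y s) (A *m dy).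
Proof.
move=> /is_derive_coordP yt; apply/is_derive_coordP => i.
rewrite (_ : (fun _ => _) = \sum_(j < p) (fun s => A i j * y s j 0)); last first.
  by apply/funext => s; rewrite fct_sumE mxE.
rewrite mxE; apply: is_derive_sum => j; exact: (is_deriveZ _ (yt j)).
Qed.

Lemma is_derive_grad (R : realType) (p : nat) (G : 'cV[R]_p -> R)
    (y : R -> 'cV[R]_p) (t : R) (dy : 'cV[R]_p) :
  differentiable G (y t) -> is_derive t (1 : R) y dy ->
  is_derive t (1 : R) (fun s => G (y s)) (dot (grad G (y t)) dy).
Proof.
move=> Gd [/derivable1_diffP yd yE].
have Gyd : differentiable (G \o y) t by exact: differentiable_comp.
apply: DeriveDef; first exact: diff_derivable.
rewrite -[LHS]/('D_1 (G \o y) t) deriveE// diff_comp//= -(deriveE (1 : R) yd) yE.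
rewrite {1}(matrix_sum_delta dy) linear_sum/=; apply: eq_bigr => i _.
by rewrite big_ord1 linearZ/= mxE deriveE// mulrC.
Qed.

(** * Continuity, compact balls and local Lipschitz bounds *)

Lemma trmx_continuous (R : realType) (m n : nat) :
  continuous (fun A : 'M[R]_(m, n) => A^T).
Proof.
move=> A S [P AP PS]; exists (fun i j => P j i) => [i j|B BP].
  by have := AP j i; rewrite mxE.
by apply: PS => i j; rewrite mxE; exact: BP.
Qed.

Section Continuity.
Context {T : topologicalType} {R : realType}.

Lemma continuous_sum (p : nat) (f : 'I_p -> T -> R) :
  (forall i, continuous (f i)) -> continuous (fun t => \sum_(i < p) f i t).
Proof.
move=> fc t; have -> : (fun s => \sum_(i < p) f i s) = \sum_(i < p) f i.
  by apply/funext => s; rewrite fct_sumE.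
elim/big_ind : _ => [|g h gc hc|i _].
- exact: cst_continuous.
- exact: continuousD.
- exact: fc.
Qed.

Lemma continuous_coord (p : nat) (f : T -> 'cV[R]_p) (i : 'I_p) :
  continuous f -> continuous (fun t => f t i 0).
Proof.
by move=> fc t; exact: (continuous_comp (fc t) (@coord_continuous R p 1 i 0 (f t))).
Qed.

Lemma dot_continuous (p : nat) (f g : T -> 'cV[R]_p) :
  continuous f -> continuous g -> continuous (fun t => dot (f t) (g t)).
Proof.
move=> fc gc; apply: continuous_sum => i t.
by apply: cvgM; [exact: (continuous_coord fc) | exact: (continuous_coord gc)].
Qed.

Lemma mulmx_continuous (p q : nat) (A : 'M[R]_(q, p)) (f : T -> 'cV[R]_p) :
  continuous f -> continuous (fun t => A *m f t).
Proof.
move=> fc t S [P AP PS].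
have : \forall s \near t, forall i : 'I_q, P i 0 ((A *m f s) i 0).
  apply: filter_forall => i; have := AP i 0; rewrite mxE.
  under [X in _ -> X]eq_near do rewrite mxE.
  apply: (@continuous_sum _ (fun j s => A i j * f s j 0)) => j s.
  by apply: cvgM; [exact: cvg_cst | exact: (continuous_coord fc)].
by apply: filterS => s Ps; apply: PS => i j; rewrite (ord1 j).
Qed.

End Continuity.

(** Transposition is a continuous isometry for the sup norm and carries compactness of closed
    bounded sets from row vectors to columns. *)
Lemma ball_compact (R : realType) (p : nat) (r : R) :
  compact [set v : 'cV[R]_p | `|v| <= r].
Proof.
have nT (v : 'cV[R]_p) : `|v^T| = `|v|.
  rewrite /Num.Def.normr/= !mx_normrE; apply/le_anti/andP; split.
    apply: bigmax_le => [|[i j] _]; last first.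
      by rewrite mxE; exact: (le_bigmax _ (fun k => `|v k.1 k.2|) (j, i)).
    exact: bigmax_ge_id.
  apply: bigmax_le => [|[i j] _].
    exact: bigmax_ge_id.
  have := (le_bigmax 0 (fun k => `|v^T k.1 k.2|) (j, i)).
  by rewrite /= mxE.
rewrite (_ : mkset _ = trmx @` [set v : 'rV[R]_p | `|v| <= r]); last first.
  apply/seteqP; split => [v vr|_ [v vr <-]]/=; last by rewrite -nT trmxK.
  by exists v^T; [rewrite /= nT | rewrite trmxK].
apply: continuous_compact.
  exact/continuous_subspaceT/trmx_continuous.
apply: bounded_closed_compact.
  by exists r; split; [exact: num_real | move=> M rM v vr; exact: le_trans (ltW rM)].
apply: (preimage_closed _ (@closed_le _ r)) => v _; exact: norm_continuous.
Qed.

Lemma bounded_on_balls (R : realType) (p : nat) (g : 'cV[R]_p -> 'cV[R]_p)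
    (r : R) :
  continuous g ->
  exists2 L : R, 0 <= L & forall v, `|v| <= r -> enorm (g v) <= L.
Proof.
move=> gc.
have : compact [set dot (g v) (g v) | v in [set v : 'cV[R]_p | `|v| <= r]].
  apply: continuous_compact (@ball_compact _ _ _).
  exact/continuous_subspaceT/dot_continuous.
(* [M] is a bound only in the sense that every larger number is one, hence [M + 1]. *)
move=> /compact_bounded[M [_ gM]]; exists (Num.sqrt (M + 1)); first exact: sqrtr_ge0.
move=> v vr; rewrite ler_wsqrtr// (le_trans (ler_norm _))//.
by apply: (gM (M + 1)); [lra | exists v].
Qed.

(** Mean value theorem on the segment from [w] to [v], which stays in the ball by convexity; there
    the continuous gradient is bounded. *)
Lemma grad_lipschitz (R : realType) (p : nat) (G : 'cV[R]_p -> R) (r : R) :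
  (forall v, differentiable G v) -> continuous (grad G) ->
  exists2 L : R, 0 <= L &
    forall v w, `|v| <= r -> `|w| <= r -> `|G v - G w| <= L * enorm (v - w).
Proof.
move=> Gd Gc; have [L L0 hL] := bounded_on_balls r Gc; exists L => // v w vr wr.
pose y s := w + s *: (v - w).
have dy (s : R) : is_derive s (1 : R) y (v - w).
  apply/is_derive_coordP => i; rewrite /y.
  rewrite (_ : (fun _ => _) = (fun s : R => w i 0 + s * (v - w) i 0)); last first.
    by apply/funext => x; rewrite !mxE.
  apply: trigger_derive.
  by rewrite add0r mul1r scaler0 add0r [_%:A]mulr1.
have dGy s : is_derive s (1 : R) (G \o y) (dot (grad G (y s)) (v - w)).
  exact: is_derive_grad.
have [||c c01] := @MVT_segment _ (G \o y) (fun s => dot (grad G (y s)) (v - w)) 0 1.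
- exact: ler01.
- apply: continuous_subspaceT => s.
  by apply/differentiable_continuous/derivable1_diffP; have [] := dGy s.
rewrite /= /y scale1r scale0r addr0 subr0 mulr1 [w + (v - w)]addrC subrK => ->.
apply: (le_trans (dot_le_enorm _ _)); rewrite ler_wpM2r ?enorm_ge0//.
apply: hL; move: c01; rewrite in_itv/= => /andP[c0 c1].
rewrite (_ : w + _ = (1 - c) *: w + c *: v); last first.
  by rewrite scalerBr scalerBl scale1r addrAC addrA.
rewrite (le_trans (ler_normD _ _))// !normrZ !ger0_norm//; last lra.
have : (1 - c) * `|w| <= (1 - c) * r by rewrite ler_wpM2l//; lra.
have : c * `|v| <= c * r by rewrite ler_wpM2l//; lra.
lra.
Qed.

(** * Symmetric and positive definite matrices *)

Section Symmetric.
Context {R : realType} {p : nat}.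
Implicit Types (A : 'M[R]_p) (v w : 'cV[R]_p).

Lemma dot_symmx A v w : A^T = A -> dot v (A *m w) = dot w (A *m v).
Proof. by move=> AT; rewrite dot_mulmx AT dotC. Qed.

(* Any minimizer of the quadratic form on the unit sphere is an eigenvector. *)
Lemma smallest_eigenvalue_dot A (lambda : R) v :
  A^T = A -> smallest_eigenvalue A lambda ->
  lambda * dot v v <= dot v (A *m v).
Proof.
move=> AT [_ lambda_le]; pose q w := dot w (A *m w).
have [->|v0] := eqVneq v 0.
  by rewrite -(scale0r (0 : 'cV[R]_p)) !dotZl !mul0r mulr0.
pose S := [set w : 'cV[R]_p | dot w w = 1].
have normalize w : w != 0 -> S ((enorm w)^-1 *: w).
  move=> w0; rewrite /S/= dotZl dotZr mulrA -expr2 exprVn sqr_enorm mulVf//.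
  by rewrite dot_eq0.
have cS : compact S.
  apply: (subclosed_compact _ (@ball_compact R p 1)).
    have cd : continuous (fun w : 'cV[R]_p => dot w w).
      by apply: dot_continuous => ?; exact: cvg_id.
    by apply: (preimage_closed _ (@closed_eq _ (1 : R))) => w _; exact: cd.
  move=> w /= ww; apply: le_trans (norm_le_enorm _) _.
  by rewrite /enorm ww sqrtr1.
have cq : {within S, continuous q}.
  apply/continuous_subspaceT/dot_continuous => [?|]; first exact: cvg_id.
  by apply: mulmx_continuous => ?; exact: cvg_id.
have [|u] := compact_EVT_min _ cS cq; first by exists ((enorm v)^-1 *: v); exact: normalize.
rewrite inE => Su umin; set mu := q u in umin.
have mu_le w : mu * dot w w <= q w.
  have [->|w0] := eqVneq w 0.
    by rewrite /q -(scale0r (0 : 'cV[R]_p)) !dotZl !mul0r mulr0.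
  have ww : 0 < dot w w by rewrite lt_neqAle eq_sym dot_eq0 w0 dot_ge0.
  have := umin _ (mem_set (normalize w w0)).
  rewrite /q -scalemxAr dotZl dotZr mulrA -expr2 exprVn sqr_enorm mulrC.
  by rewrite ler_pdivlMr.
(* The minimizer [u] is an eigenvector for [mu] once its residual [r] vanishes. *)
have [r rE] : exists r, r = A *m u - mu *: u by eexists.
have r0 : dot r r = 0.
  pose b := q r - mu * dot r r; have b0 : 0 <= b by rewrite subr_ge0.
  (* Perturbing [u] in the direction [r] gives a quadratic in [s] that is nonnegative everywhere,
     although its linear term is proportional to [dot r r]. *)
  have key s : 0 <= 2 * s * dot r r + s ^+ 2 * b.
    have := mu_le (u + s *: r); rewrite /b /q mulmxDr -scalemxAr.
    rewrite !(dotDl, dotDr, dotZl, dotZr) (dot_symmx u r AT) (dotC u r) -/(q u) -/mu.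
    rewrite (Su : dot u u = 1).
    have : dot r r = dot r (A *m u) - mu * dot r u by rewrite {2}rE dotDr dotNr dotZr.
    move=> ->; lra.
  apply/eqP; rewrite eq_le dot_ge0 andbT leNgt; apply/negP => rr.
  have b1 : 0 < b + 1 by lra.
  (* A small negative step makes the linear term win if [r] is nonzero; [b + 1] replaces [b], which
     may be zero. *)
  have := key (- (dot r r / (b + 1))); rewrite sqrrN.
  have := divr_gt0 rr b1; set s := dot r r / _ => s0.
  have : s * (b + 1) = dot r r by rewrite /s divfK// gt_eqF.
  have : 0 < s * dot r r by rewrite mulr_gt0.
  have : 0 < s ^+ 2 by rewrite exprn_gt0.
  move=> s2 srr srr' k0; have : s ^+ 2 * (b + 1) = s * dot r r by rewrite expr2 -mulrA srr'.
  lra.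
apply: le_trans (mu_le v); rewrite ler_wpM2r ?dot_ge0//; apply: lambda_le.
(* [eigenvalue] refers to row eigenvectors; by symmetry the transpose of [u] is one. *)
apply/eigenvalueP; exists u^T.
  have /eqP := r0; rewrite rE dot_eq0 subr_eq0 => /eqP Au.
  by rewrite -[A]AT -trmx_mul Au linearZ.
apply/eqP => u0; have := oner_neq0 R.
by rewrite -(Su : dot u u = 1) dot_eq0 -(trmxK u) u0 trmx0 eqxx.
Qed.

Lemma posdefmx_unit A : posdefmx A -> A \in unitmx.
Proof.
move=> [AT Apos]; rewrite -row_free_unit -kermx_eq0; apply: contraT => /rowV0Pn[w].
move=> /sub_kermxP wA w0.
have := Apos w^T; rewrite -{1}AT -trmx_mul wA trmx0 trmx_eq0 => /(_ w0).
by rewrite -(scale0r (0 : 'cV[R]_p)) dotZr mul0r ltxx.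
Qed.

Lemma posdefmx_eigenvalue_gt0 A (lambda : R) :
  posdefmx A -> eigenvalue A lambda -> 0 < lambda.
Proof.
move=> [AT Apos] /eigenvalueP[w wA w0].
have wT0 : w^T != 0 by rewrite trmx_eq0.
have := Apos _ wT0; rewrite -{1}AT -trmx_mul wA linearZ dotZr.
by rewrite pmulr_lgt0// lt_neqAle eq_sym dot_eq0 wT0 dot_ge0.
Qed.

(** With [v = A *m u], expand the square of [v - lambda *: u] and bound [lambda ^+ 2 * dot u u] by
    [lambda * dot u v]. In effect the largest eigenvalue of the inverse is at most [lambda^-1]. *)
Lemma dot_invmx_le A (lambda : R) v :
  posdefmx A -> smallest_eigenvalue A lambda ->
  lambda * dot v (invmx A *m v) <= dot v v.
Proof.
move=> Apos Alambda; have uA := posdefmx_unit Apos.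
set u := invmx A *m v; have vE : v = A *m u by rewrite mulKVmx.
have := smallest_eigenvalue_dot u Apos.1 Alambda.
have := posdefmx_eigenvalue_gt0 Apos Alambda.1; rewrite -vE => l0 /(ler_wpM2l (ltW l0)).
have := dot_ge0 (v - lambda *: u).
rewrite !(dotDl, dotDr, dotNl, dotNr, dotZl, dotZr) (dotC u v); lra.
Qed.

Lemma dot_invmx_ge0 A v : posdefmx A -> 0 <= dot v (invmx A *m v).
Proof.
move=> Apos; have uA := posdefmx_unit Apos.
set u := invmx A *m v; have -> : v = A *m u by rewrite mulKVmx.
have [->|u0] := eqVneq u 0; first by rewrite mulmx0 dot_ge0.
by rewrite dotC; apply/ltW/Apos.2.
Qed.

End Symmetric.

(** * Exponential decay and the limit superior *)

Lemma lebesgue_ae_filter (R : realType) :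
  Filter (almost_everywhere (@lebesgue_measure R)).
Proof. exact: (ae_filter_ringOfSetsType (@lebesgue_measure R)). Qed.

Lemma dissipation_decay (R : realType) (V : R -> R) (beta c : R) :
  0 < beta ->
  (forall T, 0 < T -> small_increments (fun u v => `|V v - V u|) 0 T) ->
  {ae @lebesgue_measure R, forall t, 0 < t ->
    derivable V t 1 /\ 'D_1 V t <= - beta * (V t - c)} ->
  forall t, 0 <= t -> V t <= c + (V 0 - c) * expR (- (beta * t)).
Proof.
move=> beta0 Vac Vae t; rewrite le_eqVlt => /predU1P[<-|t0].
  by rewrite mulr0 oppr0 expR0; lra.
(* Integrating factor: the differential inequality for [V] says exactly that [h] has nonpositive
   derivative. *)
pose h s := expR (beta * s) * (V s - c).
suff : h t <= h 0.
  rewrite /h mulr0 expR0 mul1r -[V t <= _]lerBlDl expRN ler_pdivlMr ?expR_gt0//.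
  by rewrite [X in _ -> X <= _]mulrC.
apply: small_increments_nonincreasing (ltW t0) _ _.
  (* [h] has small increments as a product of bounded factors: those of [V] are weighted by at most
     [E], and the exponential is Lipschitz with constant [beta * E] on the interval. *)
  have [M hM] := small_increments_bounded (ltW t0) (Vac _ t0).
  set E := expR (beta * t).
  have E0 : 0 < E := expR_gt0 _.
  have M0 : 0 <= M by rewrite (le_trans _ (hM 0 _ _))// ltW.
  have B0 : 0 <= (M + `|c|) * (beta * E).
    by apply: mulr_ge0; [apply: addr_ge0 | apply/ltW/mulr_gt0].
  have d1 := small_increments_dominated (ltW E0) (fun u v _ _ _ => lexx _) (Vac _ t0).
  have d2 := small_increments_dominated B0 (fun u v _ _ _ => lexx _)
    (@small_increments_id R 0 t).
  apply: (small_increments_dominated ler01 _ (small_incrementsD d1 d2)) => u v u0 uv vt.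
  rewrite mul1r.
  have -> : h v - h u = expR (beta * v) * (V v - V u) +
      (V u - c) * (expR (beta * v) - expR (beta * u)) by rewrite /h; ring.
  apply: (le_trans (ler_normD _ _)); rewrite !normrM; apply: lerD.
    by rewrite ler_wpM2r// ger0_norm ?expR_ge0// ler_expR ler_pM2l.
  rewrite -mulrA; apply: ler_pM => //.
    by apply: (le_trans (ler_normB _ _)); rewrite lerD2r hM//; lra.
  have bvE : expR (beta * v) <= E by rewrite ler_expR ler_pM2l.
  rewrite ger0_norm ?subr_ge0 ?ler_expR ?ler_pM2l//.
  have -> : beta * u = beta * v + - (beta * (v - u)) by ring.
  rewrite expRD; have := expR_ge1Dx (- (beta * (v - u))) => hexp.
  have : expR (beta * v) * (1 + - (beta * (v - u))) <=
      expR (beta * v) * expR (- (beta * (v - u))) by rewrite ler_wpM2l ?expR_ge0.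
  have : expR (beta * v) * (beta * (v - u)) <= E * (beta * (v - u)).
    by rewrite ler_wpM2r// mulr_ge0; lra.
  lra.
apply: (@filterS _ _ (lebesgue_ae_filter R) _ _ _ Vae) => s + s0 => /(_ s0)[Vs DVs].
have Vs' : is_derive s (1 : R) V ('D_1 V s) by exact: DeriveDef.
have hs : is_derive s (1 : R) h (expR (beta * s) * ('D_1 V s + beta * (V s - c))).
  apply: trigger_derive.
  by rewrite subr0 [beta%:A]mulr1 /GRing.scale/=; ring.
have [hd ->] := hs; split => //.
by rewrite mulr_ge0_le0 ?expR_ge0//; lra.
Qed.

(** On a bounded time interval the trajectory stays in a ball, on which [G] is Lipschitz. *)
Lemma solves_small_increments_goal (R : realType) (p : nat) (G : 'cV[R]_p -> R)
    (y g : R -> 'cV[R]_p) (T : R) :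
  (forall v, differentiable G v) -> continuous (grad G) -> solves y g -> 0 < T ->
  small_increments (fun u v => `|G (y v) - G (y u)|) 0 T.
Proof.
move=> Gd Gc [yac _] T0.
have [M hM] := abs_continuous_bounded (ltW T0) (yac T T0).
have [L L0 hL] := grad_lipschitz M Gd Gc.
apply: (small_increments_dominated L0 _ (yac T T0)) => u v u0 uv vT.
by apply: hL; apply: hM => //; [exact: le_trans uv | exact: le_trans vT].
Qed.

(** For symmetric [A] the difference of the two quadratic values factors as
    [dot (A *m (z + w)) (z - w)], with a bounded first factor. *)
Lemma small_increments_quadratic (R : realType) (p : nat) (A : 'M[R]_p)
    (y : R -> 'cV[R]_p) (y0 : 'cV[R]_p) (a b : R) :
  A^T = A -> a <= b -> abs_continuous y a b ->
  small_increments (fun u v =>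
    `|dot (y v - y0) (A *m (y v - y0)) - dot (y u - y0) (A *m (y u - y0))|) a b.
Proof.
move=> AT ab yac; have [M hM] := abs_continuous_bounded ab yac.
have [|L L0 hL] := @bounded_on_balls _ _ (fun v => A *m v) (2 * (M + `|y0|)).
  by apply: mulmx_continuous => ?; exact: cvg_id.
have sy : small_increments (fun u v => enorm (y v - y u)) a b := yac.
apply: (small_increments_dominated L0 _ sy) => u v au uv vb.
have diff_sq (z w : 'cV[R]_p) :
    dot z (A *m z) - dot w (A *m w) = dot (A *m (z + w)) (z - w).
  rewrite [RHS]dotC mulmxDr !(dotDl, dotDr, dotNl, dotNr) (dot_symmx z w AT); ring.
rewrite diff_sq (_ : y v - y0 - (y u - y0) = y v - y u); last first.
  by rewrite opprB addrA subrK.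
apply: (le_trans (dot_le_enorm _ _)); rewrite ler_wpM2r ?enorm_ge0//; apply: hL.
have zM : `|y v - y0| <= M + `|y0|.
  by rewrite (le_trans (ler_normB _ _))// lerD2r hM//; lra.
have wM : `|y u - y0| <= M + `|y0|.
  by rewrite (le_trans (ler_normB _ _))// lerD2r hM//; lra.
by rewrite (le_trans (ler_normD _ _))//; lra.
Qed.

Lemma limsup_goal_le (R : realType) (n m : nat) (xi : problem R n m)
    (x : R -> 'cV[R]_n) (beta c K : R) :
  0 < beta ->
  (forall t, 0 <= t -> goal xi (x t) <= c + K * expR (- (beta * t))) ->
  (limsup_goal xi x <= c%:E)%E.
Proof.
move=> beta0 hx; apply/lee_addgt0Pr => e e0.
have be0 : 0 < beta * e by rewrite mulr_gt0.
(* Beyond this time [e * expR (beta * t) >= e * (1 + beta * t) >= |K|], so the transient is at most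
   [e]. *)
pose T := `|K| / (beta * e).
have T0 : 0 <= T by rewrite divr_ge0// ltW.
apply: ge_ereal_inf; exists (ereal_sup ((fun t => (goal xi (x t))%:E) @` [set t | T < t])).
  by exists [set t | T < t] => //; exists T; split => //; exact: num_real.
apply: ge_ereal_sup => _ [t /= Tt <-]; rewrite -EFinD lee_fin.
apply: (le_trans (hx t _)); first by rewrite (le_trans T0)// ltW.
rewrite lerD2l (le_trans (ler_norm _))// normrM expRN normfV ler_pdivrMr; last first.
  by rewrite normr_gt0 gt_eqF// expR_gt0.
rewrite (ger0_norm (expR_ge0 _)).
have : T * (beta * e) = `|K| by rewrite /T divfK// gt_eqF.
have : T * (beta * e) <= t * (beta * e) by rewrite ler_wpM2r// ltW.
have : e * (1 + beta * t) <= e * expR (beta * t).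
  by rewrite ler_wpM2l ?expR_ge1Dx// ltW.
lra.
Qed.

(** * Dissipation estimates for the closed loop *)

Section Rate.
Context {R : realType} {n m : nat}.
Variables (alpha0 alpha1 sigma Delta_f : R) (xi : problem R n m).
Hypotheses (alpha0_gt0 : 0 < alpha0) (alpha1_gt0 : 0 < alpha1).
Hypotheses (sigma_ge0 : 0 <= sigma) (sigma_lt1 : sigma < 1).
Hypothesis Delta_f_gt0 : 0 < Delta_f.
Hypothesis Xi_xi : Xi alpha0 alpha1 sigma Delta_f xi.

Let Q := goal xi.
Let d := (Delta_f * alpha1 / alpha0) `^ (1 - sigma)^-1.
Let beta := alpha0 * (1 - sigma).

Lemma young_powR (q : R) : 0 <= q ->
  alpha1 * q `^ sigma * Delta_f <= alpha0 * ((1 - sigma) * d + sigma * q).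
Proof.
move=> q0; set a := Delta_f * alpha1 / alpha0.
have a0 : 0 < a by rewrite divr_gt0// mulr_gt0.
have s1 : 0 < 1 - sigma by rewrite subr_gt0.
have -> : alpha1 * q `^ sigma * Delta_f = alpha0 * (a * q `^ sigma).
  by rewrite /a; field; rewrite gt_eqF.
(* For [sigma = 0] the exponent conjugate to [(1 - sigma)^-1] would be infinite, and the two sides
   coincide. Otherwise Young's inequality is applied to [a] and [q] to the power [sigma]. *)
rewrite ler_pM2l//; move: sigma_ge0; rewrite le_eqVlt => /predU1P[s0|s0].
  by rewrite /d -/a -s0 powRr0 mul0r subr0 invr1 mulr1 powRr1 ?(ltW a0)// mul1r addr0 lexx.
have := @conjugate_powR _ a (q `^ sigma) (1 - sigma)^-1 sigma^-1.
rewrite -powRrM mulfV ?gt_eqF// powRr1// !invrK (mulrC _ (1 - sigma)) (mulrC q).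
by apply; rewrite ?powR_ge0 ?invr_gt0 ?(ltW a0)//; lra.
Qed.

(** Convexity compares the speed at [th] with that at [th_star], where it is at most
    [- alpha0 * Q x]. Young's inequality for the disturbance gives back [alpha0 * sigma * Q x],
    which leaves the rate [beta]. *)
Lemma goal_rate (th_star : 'cV[R]_m) (x : 'cV[R]_n) (th : 'cV[R]_m) (t : R) :
  attains alpha0 xi th_star -> 0 <= t ->
  dot (grad Q x) (plant xi x th t + disturbance xi t) <=
    - beta * (Q x - d) + dot (th - th_star) (grad_speed xi x th t).
Proof.
move=> att t0.
have hf : dot (grad Q x) (disturbance xi t) <= alpha1 * Q x `^ sigma * Delta_f.
  apply: (le_trans (ler_norm _)); apply: (le_trans (dot_le_enorm _ _)).
  apply: ler_pM; rewrite ?enorm_ge0//; first exact: (grad_goal_growth Xi_xi).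
  exact: (disturbance_bounded Xi_xi).
have := young_powR (goal_ge0 Xi_xi x).
have := speed_convex Xi_xi x th th_star t0; have := att x t t0.
rewrite -[th_star - th]opprB dotNl dotDr -/(speed xi x th t) -/Q /beta; lra.
Qed.

Lemma const_algorithm_limsup (th_star : 'cV[R]_m) :
  attains alpha0 xi th_star -> J_le xi (@const_algorithm R n m th_star) d.
Proof.
move=> att x theta [xs theta_const].
have beta0 : 0 < beta by rewrite mulr_gt0// subr_gt0.
apply: (limsup_goal_le beta0); apply: dissipation_decay => // [T T0|].
  exact: (solves_small_increments_goal (goal_differentiable Xi_xi)
    (goal_grad_continuous Xi_xi) xs).
apply: (@filterS _ _ (lebesgue_ae_filter R) _ _ _ xs.2) => t + t0 => /(_ t0) xt.
have [hd ->] := is_derive_grad (goal_differentiable Xi_xi (x t)) xt; split => //.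
apply: le_trans (goal_rate (x t) (theta t) att (ltW t0)) _.
rewrite theta_const ?(ltW t0)// subrr -(scale0r (0 : 'cV[R]_m)) dotZl mul0r addr0.
exact: lexx.
Qed.

Lemma adaptation_limsup (Gamma : 'M[R]_m) (lambda k rho rho' : R)
    (zeta : 'cV[R]_m -> 'cV[R]_m)
    (psi : 'cV[R]_n -> 'cV[R]_m -> R -> 'cV[R]_m) (th_star : 'cV[R]_m) :
  posdefmx Gamma -> smallest_eigenvalue Gamma lambda -> 0 < k -> 0 < rho ->
  pseudogradient xi psi -> attains alpha0 xi th_star ->
  condition_NF zeta rho rho' th_star -> beta <= 2 * rho * lambda ->
  J_le xi (adaptation Gamma k zeta xi psi) (d + rho' / (k * beta)).
Proof.
move=> Gpos Glambda k0 rho0 psi_ge0 att NF gain x theta [xs etas].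
set eta := fun t => theta t + psi (x t) (theta t) t in etas.
have beta0 : 0 < beta by rewrite mulr_gt0// subr_gt0.
pose A := invmx Gamma; have AT : A^T = A by rewrite trmx_inv Gpos.1.
pose z t := eta t - th_star; pose q t := dot (z t) (A *m z t).
have q0 t : 0 <= q t by exact: dot_invmx_ge0.
have k20 : 0 <= (2 * k)^-1 by rewrite invr_ge0; lra.
pose V t := Q (x t) + (2 * k)^-1 * q t.
have VQ t : Q (x t) <= V t by rewrite lerDl mulr_ge0.
suff Vdecay : forall t, 0 <= t -> V t <= d + rho' / (k * beta) +
    (V 0 - (d + rho' / (k * beta))) * expR (- (beta * t)).
  by apply: (limsup_goal_le beta0) => t t0; apply: le_trans (VQ t) (Vdecay t t0).
apply: dissipation_decay => // [T T0|].
  have d1 := solves_small_increments_goal (goal_differentiable Xi_xi)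
    (goal_grad_continuous Xi_xi) xs T0.
  have d2 := small_increments_dominated k20 (fun u v _ _ _ => lexx _)
    (small_increments_quadratic th_star AT (ltW T0) (etas.1 T T0)).
  apply: (small_increments_dominated ler01 _ (small_incrementsD d1 d2)) => u v _ _ _.
  rewrite mul1r -[in leRHS](ger0_norm k20) -normrM.
  rewrite [X in `|X|](_ : _ = Q (x v) - Q (x u) + (2 * k)^-1 * (q v - q u)); last first.
    by rewrite /V; ring.
  exact: ler_normD.
have aeI := @filterI _ _ (lebesgue_ae_filter R) _ _ xs.2 etas.2.
apply: (@filterS _ _ (lebesgue_ae_filter R) _ _ _ aeI) => t [+ +] t0.
move=> /(_ t0) xt /(_ t0) etat.
have Qt := is_derive_grad (goal_differentiable Xi_xi (x t)) xt.
set g := grad_speed xi (x t) (theta t) t in etat.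
set u := k *: g + zeta (eta t) in etat.
have zt : is_derive t (1 : R) z (- (Gamma *m u)).
  by rewrite -[X in is_derive _ _ _ X]subr0; exact: is_deriveB.
(* The matrix [A], inverse to [Gamma], cancels the gain in the derivative of [z]. *)
have qt : is_derive t (1 : R) q (- (2 * dot (z t) u)).
  have := is_derive_dot zt (is_derive_mulmx A zt).
  rewrite -mulNr (dot_symmx _ _ AT) mulmxN mulmxA mulVmx ?mul1mx ?dotNr; last first.
    exact: posdefmx_unit.
  by move/trigger_derive; apply; ring.
have [hV ->] : is_derive t (1 : R) V (dot (grad Q (x t))
    (plant xi (x t) (theta t) t + disturbance xi t) - k^-1 * dot (z t) u).
  have qt' := is_deriveZ (2 * k)^-1 qt.
  have Vt : is_derive t (1 : R) V _ := is_deriveD Qt qt'.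
  apply: (trigger_derive Vt).
  by rewrite /GRing.scale/= /Q; field; rewrite gt_eqF.
split => //.
have := goal_rate (x t) (theta t) att (ltW t0); rewrite -/g.
have := psi_ge0 (x t) (theta t) t (ltW t0); rewrite -/g.
have := NF (eta t); rewrite sqr_enorm (dotC (zeta _)) -/(z t).
have := dot_invmx_le (z t) Gpos Glambda; rewrite -/A -/(q t).
(* The first summand cancels the gradient term of [goal_rate]; the second is nonnegative by the
   pseudogradient condition. *)
have zg : dot (z t) g = dot (theta t - th_star) g + dot (psi (x t) (theta t) t) g.
  by rewrite /z /eta addrAC [LHS]dotDl.
have -> : k^-1 * dot (z t) u = dot (z t) g + k^-1 * dot (z t) (zeta (eta t)).
  by rewrite /u dotDr dotZr mulrDr mulKf// gt_eqF.
have -> : - beta * (V t - (d + rho' / (k * beta))) =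
    - beta * (Q (x t) - d) - k^-1 * ((beta * q t) / 2 - rho').
  by rewrite /V; field; rewrite !gt_eqF.
have ki0 : 0 <= k^-1 by rewrite invr_ge0 ltW.
rewrite zg => lq NFt psi0 Qrate.
(* The gain condition, [dot_invmx_le] and NF chain into [beta * q t / 2 - rho' <= dot (z t) (zeta
   (eta t))]. *)
have bq : beta * q t <= 2 * rho * lambda * q t by rewrite ler_wpM2r.
have rlq : rho * (lambda * q t) <= rho * dot (z t) (z t) by rewrite ler_wpM2l// ltW.
have : k^-1 * ((beta * q t) / 2 - rho') <= k^-1 * dot (z t) (zeta (eta t)).
  by rewrite ler_wpM2l//; lra.
lra.
Qed.

End Rate.

(* MathComp-Analysis.  C is any class of problems contained in Xi_1(Delta_star)
   on which condition NF holds with the given zeta, rho and rho'; C may be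
   Xi_1(Delta_star) itself or a single problem. *)
Theorem theorem1 (R : realType) (n m : nat)
    (alpha0 alpha1 sigma Delta_f Delta_star : R)
    (alpha0_gt0 : 0 < alpha0) (alpha1_gt0 : 0 < alpha1)
    (sigma_ge0 : 0 <= sigma) (sigma_lt1 : sigma < 1)
    (Delta_f_gt0 : 0 < Delta_f)
    (Delta_star_ge :
       (Delta_f * alpha1 / alpha0) `^ (1 - sigma)^-1 <= Delta_star)
    (Gamma : 'M[R]_m) (Gamma_posdef : posdefmx Gamma)
    (lambda : R) (lambda_min : smallest_eigenvalue Gamma lambda)
    (k : R) (k_gt0 : 0 < k)
    (zeta : 'cV[R]_m -> 'cV[R]_m)
    (rho rho' : R) (rho_gt0 : 0 < rho) (rho'_gt0 : 0 < rho')
    (C : set (problem R n m))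
    (C_Xi1 : C `<=` Xi1 alpha0 alpha1 sigma Delta_f Delta_star)
    (psi : problem R n m -> 'cV[R]_n -> 'cV[R]_m -> R -> 'cV[R]_m)
    (psi_pseudogradient : forall xi, C xi -> pseudogradient xi (psi xi))
    (NF : forall xi, C xi -> exists2 th_star : 'cV[R]_m,
       attains alpha0 xi th_star & condition_NF zeta rho rho' th_star)
    (gain : alpha0 * (1 - sigma) <= 2 * rho * lambda) :
  (forall xi, C xi ->
     ultimately_bounded xi (adaptation Gamma k zeta xi (psi xi))) /\
  (forall eps : R, 0 < eps ->
     2 * rho' * (eps * alpha0 * (1 - sigma))^-1 < k ->
     estimatedly_optimal C Delta_star eps
       (fun xi => adaptation Gamma k zeta xi (psi xi))).
Proof.
pose d := (Delta_f * alpha1 / alpha0) `^ (1 - sigma)^-1.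
pose beta := alpha0 * (1 - sigma).
have beta0 : 0 < beta by rewrite mulr_gt0// subr_gt0.
have J_adaptation xi : C xi ->
    J_le xi (adaptation Gamma k zeta xi (psi xi)) (d + rho' / (k * beta)).
  move=> Cxi; have [th_star att NFxi] := NF xi Cxi.
  exact: (adaptation_limsup alpha0_gt0 alpha1_gt0 sigma_ge0 sigma_lt1 Delta_f_gt0
    (C_Xi1 _ Cxi).1 Gamma_posdef lambda_min k_gt0 rho_gt0 (psi_pseudogradient _ Cxi)
    att NFxi gain).
have J_leW xi Theta (c c' : R) : c <= c' -> J_le xi Theta c -> @J_le R n m xi Theta c'.
  by move=> cc' Jc x theta cl; apply: le_trans (Jc x theta cl) _; rewrite lee_fin.
split=> [xi Cxi|eps eps0 k_gt].
  exists (d + rho' / (k * beta)); last exact: J_adaptation.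
  by rewrite ltr_wpDl ?powR_ge0// divr_gt0// mulr_gt0.
split=> xi Cxi.
  have Xi_xi := (C_Xi1 _ Cxi).1; have [th_star att] := attainable Xi_xi.
  exists (const_algorithm th_star).
    by rewrite (admissible_const Xi_xi); exists th_star.
  apply: J_leW Delta_star_ge _.
  exact: (const_algorithm_limsup alpha0_gt0 alpha1_gt0 sigma_ge0 sigma_lt1 Delta_f_gt0).
(* The threshold on [k] makes the excess [rho' / (k * beta)] smaller than [eps / 2]. *)
apply: J_leW (J_adaptation xi Cxi); rewrite lerD// ler_pdivrMr ?(mulr_gt0 k_gt0 beta0)//.
move: k_gt; rewrite -(mulrA eps) -/beta ltr_pdivrMr.
  by lra.
exact: mulr_gt0.
Qed.
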